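(* Let $k\ge1$ and let $\mathfrak G_\varphi=(\mathcal S,\mathcal A,\mathsf T,\mathcal F_\varphi,s_{\mathrm{init}})$ be a $k$-th order differential safety game with history game $\mathfrak G^k_\varphi=(\mathcal S^{\le k+1},\mathcal A,\mathsf T^k,\mathcal F^k_\varphi,(s_{\mathrm{init}}))$. 1. $\mathfrak G_\varphi^k$ is a safety game, i.e. $\mathcal F^k_\varphi$ is a state invariance condition on $\mathcal S^{\le k+1}$: there is a set $G\subseteq\mathcal S^{\le k+1}$ such that, for every path $w$ of $\mathfrak G_\varphi$, the lifted history path of $w$ belongs to $\mathcal F_\varphi^k$ if and only if all of its entries lie in $G$. 2. A memoryless strategy $\xi^k\colon\mathcal S^{\le k+1}\to2^{\mathcal A}$ is winning for $\mathfrak G^k_\varphi$ if and only if the induced $(k+1)$-history dependent strategy $\xi$, given by $\xi(s_1\cdots s_t)=\xi^k(s_{\max\{1,t-k\}},\dots,s_t)$ for $t\ge1$, is winning for $\mathfrak G_\varphi$.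
   Context: **Sequences.** $\mathbb N=\{0,1,2,\dots\}$, $\mathbb N_+=\{1,2,\dots\}$. For a set $X$, $X^*$ and $X^\omega$ are the finite and infinite sequences over $X$, $X^\infty=X^*\cup X^\omega$, and $X^{\le m}$ is the set of nonempty sequences of length at most $m$. For $w=s_1s_2\cdots$, $|w|$ is its length and $w_{m:n}=s_m\cdots s_n$. **Discrete derivatives.** $\mathcal S\subseteq\mathbb R^d$ is finite and $\Delta\tau>0$ is a fixed time step. For $w=s_1s_2\cdots\in\mathcal S^\infty$, $\partial^0_t(w)=s_t$ and $\partial^k_t(w)=(\partial^{k-1}_t(w)-\partial^{k-1}_{t-1}(w))/\Delta\tau$, for $k<t\le|w|$. **Differential safety properties.** These are the formulas $\varphi::=(\partial^k\in\mathcal R)\mid\varphi\land\varphi\mid\lnot\varphi$ with $k\in\mathbb N$, $\mathcal R\subseteq\mathbb R^d$. The order $\mathrm{ord}(\varphi)$ is the largest $k$ occurring in an atom $(\partial^k\in\mathcal R)$ of $\varphi$. For $\mathrm{ord}(\varphi)+1\le t\le|w|$, the local value $[\![\varphi]\!]_t(w)\in\{\top,\bot\}$ is defined by: $[\![\partial^j\in\mathcal R]\!]_t(w)=\top$ iff $\partial^j_t(w)\in\mathcal R$, extended to Boolean connectives as usual. Globally, for $\mathrm{ord}(\varphi)=k$, $w\models\varphi$ iff $[\![\varphi]\!]_t(w)=\top$ for all $t$ with $k+1\le t\le|w|$. **Games and strategies.** A turn-based game is $\mathfrak G=(Q,\mathcal A,\mathsf T,\mathcal F,q_{\mathrm{init}})$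 with finite state set $Q$, finite nonempty action set $\mathcal A$, $\mathsf T\colon Q\times\mathcal A\to2^{Q}$ with all values nonempty, winning condition $\mathcal F\subseteq Q^\omega$, and $q_{\mathrm{init}}\in Q$. Write $q\xrightarrow{a}q'$ if $q'\in\mathsf T(q,a)$, and $q\to q'$ if this holds for some $a$. A path is $w=q_1q_2\cdots\in Q^\omega$ with $q_t\to q_{t+1}$ for all $t$; it is winning if $w\in\mathcal F$. A strategy is a map $\xi\colon Q^*\to2^{\mathcal A}$; it is $m$-history dependent if $\xi(w)$ depends only on the last $\min\{|w|,m\}$ entries of $w$, and memoryless if $m=1$ (then written as a map $Q\to2^{\mathcal A}$). A sequence $w=q_1q_2\cdots\in Q^\infty$ is consistent with $\xi$ if for every $t<|w|$ there is $a\in\xi(w_{1:t})$ with $q_t\xrightarrow{a}q_{t+1}$. $\xi$ is winning if $\xi(w)\ne\emptyset$ for every finite nonempty $w$ starting in $q_{\mathrm{init}}$ and consistent with $\xi$, and every path starting in $q_{\mathrm{init}}$ and consistent with $\xi$ is winning. A $k$-th order differential safety game $\mathfrak G_\varphi=(\mathcal S,\mathcal A,\mathsf T,\mathcal F_\varphi,s_{\mathrm{init}})$ is a turn-based game with $\mathcal S\subseteq\mathbb R^d$ finite and $\mathcal F_\varphi=\{w\in\mathcal S^\omega:w\models\varphi\}$, where $\mathrm{ord}(\varphi)=k$. **History game.** $\mathfrak G^k_\varphi$ has state set $\mathcal S^{\le k+1}$, initial state $(s_{\mathrm{init}})$, and transitions $\mathsf T^k((s_1,\dots,s_j),a)=\{(s_1,\dots,s_j,s'):s'\in\mathsf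 T(s_j,a)\}$ if $j<k+1$, and $\mathsf T^k((s_1,\dots,s_{k+1}),a)=\{(s_2,\dots,s_{k+1},s'):s'\in\mathsf T(s_{k+1},a)\}$. The lifted history path of $w\in\mathcal S^\omega$ is $(w_{\max\{1,t-k\}:t})_{t\in\mathbb N_+}$; the lifted paths of paths of $\mathfrak G_\varphi$ are exactly the paths of $\mathfrak G_\varphi^k$ starting in a history of length 1. The winning condition $\mathcal F^k_\varphi$ is such that the lifted history path of $w$ belongs to $\mathcal F^k_\varphi$ if and only if $w\in\mathcal F_\varphi$. *)

(* Defs.v *)
From mathcomp Require Import all_boot all_order all_algebra.
From mathcomp Require Import finmap.
From mathcomp Require Import classical_sets reals.

Set Implicit Arguments.
Unset Strict Implicit.
Unset Printing Implicit Defensive.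

Import Order.TTheory GRing.Theory Num.Theory.
Local Open Scope ring_scope.

(* An infinite sequence s_1 s_2 ... over X is a function w : nat -> X with
   s_t = w t.-1; time is thus shifted by one, and "k < t" becomes "k <= t". *)

Section DifferentialSafety.
Variables (R : realType) (d : nat).

(* Meaningful for k <= t only; the predecessor t.-1 is then a true one whenever
   it is used. *)
Fixpoint dderiv (dt : R) (k : nat) (w : nat -> 'rV[R]_d) (t : nat) : 'rV[R]_d :=
  if k is k'.+1 then dt^-1 *: (dderiv dt k' w t - dderiv dt k' w t.-1) else w t.

Inductive formula : Type :=
| FAtom of nat & set 'rV[R]_d
| FAnd of formula & formula
| FNot of formula.

Fixpoint ford (phi : formula) : nat :=
  match phi with
  | FAtom k _ => k
  | FAnd phi1 phi2 => maxn (ford phi1) (ford phi2)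
  | FNot phi1 => ford phi1
  end.

Fixpoint local_val (dt : R) (phi : formula) (w : nat -> 'rV[R]_d) (t : nat) :
    Prop :=
  match phi with
  | FAtom k A => A (dderiv dt k w t)
  | FAnd phi1 phi2 => local_val dt phi1 w t /\ local_val dt phi2 w t
  | FNot phi1 => ~ local_val dt phi1 w t
  end.

Definition fsat (dt : R) (phi : formula) (w : nat -> 'rV[R]_d) : Prop :=
  forall t : nat, (ford phi <= t)%N -> local_val dt phi w t.

End DifferentialSafety.

Record game (Q A : finType) : Type := Game {
  act_nonempty : (0 < #|A|)%N;
  trans : Q -> A -> {set Q};
  trans_nonempty : forall q a, trans q a != finset.set0;
  win : set (nat -> Q);
  init : Q
}.

Section Games.
Variables (Q A : finType) (G : game Q A).

Definition edge (q q' : Q) : Prop := exists a : A, q' \in trans G q a.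

Definition is_path (w : nat -> Q) : Prop := forall t : nat, edge (w t) (w t.+1).

Definition strategy : Type := seq Q -> {set A}.

Definition history_dependent (m : nat) (xi : strategy) : Prop :=
  forall w w' : seq Q,
    drop (size w - m) w = drop (size w' - m) w' -> xi w = xi w'.

(* The value on the empty sequence is never consulted by [winning]. *)
Definition of_memoryless (xi : Q -> {set A}) : strategy :=
  fun w => if w is q :: w' then xi (last q w') else finset.set0.

Definition consistent_fin (xi : strategy) (w : seq Q) : Prop :=
  forall t : nat, (t.+1 < size w)%N ->
    exists2 a : A, a \in xi (take t.+1 w) &
      nth (init G) w t.+1 \in trans G (nth (init G) w t) a.

Definition consistent_inf (xi : strategy) (w : nat -> Q) : Prop :=
  forall t : nat,
    exists2 a : A, a \in xi (mkseq w t.+1) & w t.+1 \in trans G (w t) a.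

Definition winning (xi : strategy) : Prop :=
  (forall w : seq Q,
     consistent_fin xi (init G :: w) -> xi (init G :: w) != finset.set0) /\
  (forall w : nat -> Q,
     is_path w -> w 0%N = init G -> consistent_inf xi w -> win G w).

End Games.

Definition diff_safety_game (R : realType) (d : nat) (dt : R)
    (S : {fset 'rV[R]_d}) (A : finType) (k : nat) (phi : formula R d)
    (G : game S A) : Prop :=
  ford phi = k /\
  win G = [set w : nat -> S | fsat dt phi (fun t => val (w t))]%classic.

(* Nonempty sequences of length at most k + 1. *)
Definition history (k : nat) (Q : finType) : Type :=
  {h : k.+1.-bseq Q | (0 < size h)%N}.

Definition hseq (k : nat) (Q : finType) (h : history k Q) : seq Q := val (val h).

Section Histories.
Variables (k : nat) (Q : finType).

Lemma hist1_subproof (q : Q) : (size [:: q] <= k.+1)%N.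
Proof. by []. Qed.

Definition hist1 (q : Q) : history k Q :=
  exist _ (Bseq (hist1_subproof q)) isT.

Lemma window_size_subproof (q : Q) (w : seq Q) :
  (size (drop (size (q :: w) - k.+1) (q :: w)) <= k.+1)%N.
Proof. by rewrite size_drop leq_subLR addnC -leq_subLR. Qed.

Lemma window_gt0_subproof (q : Q) (w : seq Q) :
  (0 < size (Bseq (window_size_subproof q w)))%N.
Proof. by rewrite size_drop subn_gt0 /= subSS ltnS leq_subr. Qed.

(* The last min(t, k + 1) entries s_{max(1, t - k)}, ..., s_t of the nonempty
   sequence s_1 ... s_t = q :: w. *)
Definition window (q : Q) (w : seq Q) : history k Q :=
  exist _ (Bseq (window_size_subproof q w)) (window_gt0_subproof q w).

(* The sequence q_1 ... q_(t+1) is passed to [window] as its head and tail. *)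
Definition lift_path (w : nat -> Q) : nat -> history k Q :=
  fun t => window (w 0%N) [seq w i | i <- iota 1 t].

Definition extend (s : seq Q) (q : Q) : seq Q :=
  if (size s < k.+1)%N then rcons s q else rcons (behead s) q.

Lemma hext_size_subproof (h : history k Q) (q : Q) :
  (size (extend (hseq h) q) <= k.+1)%N.
Proof.
rewrite /extend; case: ifP => hk; rewrite size_rcons //.
rewrite size_behead prednK; first exact: size_bseq (val h).
exact: valP h.
Qed.

Lemma hext_gt0_subproof (h : history k Q) (q : Q) :
  (0 < size (Bseq (hext_size_subproof h q)))%N.
Proof. by rewrite /= /extend; case: ifP; rewrite size_rcons. Qed.

Definition hext (h : history k Q) (q : Q) : history k Q :=
  exist _ (Bseq (hext_size_subproof h q)) (hext_gt0_subproof h q).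

End Histories.

Section HistoryGame.
Variables (k : nat) (Q A : finType) (G : game Q A).

(* [init G] is only the default of [last]: histories are nonempty. *)
Definition htrans (h : history k Q) (a : A) : {set history k Q} :=
  [set hext h q | q in trans G (last (init G) (hseq h)) a]%SET.

Lemma htrans_nonempty (h : history k Q) (a : A) : htrans h a != finset.set0.
Proof. by rewrite imset_eq0 trans_nonempty. Qed.

Definition history_win (Fk : set (nat -> history k Q)) : Prop :=
  forall w : nat -> Q, Fk (lift_path k w) <-> win G w.

Definition history_game (Fk : set (nat -> history k Q)) : game (history k Q) A :=
  {| act_nonempty := act_nonempty G;
     trans := htrans;
     trans_nonempty := htrans_nonempty;
     win := Fk;
     init := hist1 k (init G) |}.

(* As for [of_memoryless], the value on the empty sequence is irrelevant. *)
Definition induced (xik : history k Q -> {set A}) : strategy Q A :=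
  fun w => if w is q :: w' then xik (window k q w') else finset.set0.

End HistoryGame.

(* Main.v *)
Require Import Defs.
From mathcomp Require Import all_boot all_order all_algebra.
From mathcomp Require Import finmap.
From mathcomp Require Import boolp classical_sets reals.
Local Open Scope ring_scope.

(** The [j]-th derivative at time [t] only reads the entries [t - j, ..., t],
    so a formula of order [k] is evaluated at [t] on the window of length
    [k + 1] ending at [t]; windows not yet full impose no constraint.  For
    strategies, [lift_path] is a bijection between sequences of states starting
    in [init G] and sequences of histories starting in [hist1 (init G)] that
    follow [hext] (the inverse takes last entries), and it matches the choices
    of [induced xik] with those of [xik]. *)

(** Two separate times are allowed so that time [t] of a path can be compared with the last position
    of a stored window. The bounds by [j] keep every subtraction and predecessor untruncated. *)
Lemma dderiv_local {R : realType} {d : nat} (dt : R) (j t t' : nat)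
    (w w' : nat -> 'rV[R]_d) :
  (j <= t)%N -> (j <= t')%N ->
  (forall i, (i <= j)%N -> w (t - i)%N = w' (t' - i)%N) ->
  dderiv dt j w t = dderiv dt j w' t'.
Proof.
elim: j t t' => [|j IHj] t t' le_jt le_jt' eq_ww' /=.
  by have := eq_ww' 0%N isT; rewrite !subn0.
congr (_ *: (_ - _)).
  by apply: IHj => [||i le_ij]; [exact: ltnW|exact: ltnW|apply/eq_ww'/leqW].
(* Entry [i] before the predecessor is entry [i.+1] before the original time. *)
apply: IHj => [||i le_ij]; rewrite -?subn1 ?leq_subRL ?add1n //.
- exact: leq_trans le_jt.
- exact: leq_trans le_jt'.
- by rewrite -!subnDA add1n eq_ww'.
Qed.

Lemma local_val_local {R : realType} {d : nat} (dt : R) (phi : formula R d)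
    (t t' : nat) (w w' : nat -> 'rV[R]_d) :
  (ford phi <= t)%N -> (ford phi <= t')%N ->
  (forall i, (i <= ford phi)%N -> w (t - i)%N = w' (t' - i)%N) ->
  local_val dt phi w t <-> local_val dt phi w' t'.
Proof.
elim: phi => [j B|phi1 IH1 phi2 IH2|phi IH] /=.
- by move=> le_t le_t' eq_ww'; rewrite (@dderiv_local _ _ _ j t t' w w').
- rewrite !geq_max => /andP[le1 le2] /andP[le1' le2'] eq_ww'.
  have [||i le_i|h1 h1'] := IH1; rewrite ?eq_ww' ?leq_max ?le_i //.
  have [||i le_i|h2 h2'] := IH2; rewrite ?eq_ww' ?leq_max ?le_i ?orbT //.
  by split=> -[/[swap]]; split; auto.
- by move=> le_t le_t' eq_ww'; have [] := IH le_t le_t' eq_ww'; split; auto.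
Qed.

Lemma mkseqS_cons {T : Type} (w : nat -> T) (n : nat) :
  mkseq w n.+1 = w 0%N :: [seq w i | i <- iota 1 n].
Proof. by []. Qed.

(** Turns a finite play into a prefix of a function on [nat], so that finite and infinite plays are
    handled alike. *)
Lemma nth_cons_mkseq {T : Type} (q : T) (s : seq T) :
  q :: s = mkseq (nth q (q :: s)) (size s).+1.
Proof. by rewrite -[LHS](mkseq_nth q). Qed.

Section Steps.
Context {Q A : finType} (G : game Q A).

Definition follows (xi : strategy Q A) (w : nat -> Q) (t : nat) : Prop :=
  exists2 a : A, a \in xi (mkseq w t.+1) & w t.+1 \in trans G (w t) a.

Lemma consistent_fin_mkseq (xi : strategy Q A) (w : nat -> Q) (n : nat) :
  consistent_fin G xi (mkseq w n.+1) <->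
  forall t, (t < n)%N -> follows xi w t.
Proof.
have stepE t : (t < n)%N ->
    (exists2 a : A, a \in xi (take t.+1 (mkseq w n.+1)) &
      nth (init G) (mkseq w n.+1) t.+1 \in
        trans G (nth (init G) (mkseq w n.+1) t) a) = follows xi w t.
  move=> lt_tn; rewrite !nth_mkseq ?ltnS // 1?ltnW //.
  by rewrite /mkseq -map_take take_iota (minn_idPl _) // ltnS ltnW.
rewrite /consistent_fin size_mkseq; split=> cons_w t lt_tn.
  by rewrite -stepE //; apply: cons_w.
by rewrite stepE //; apply: cons_w.
Qed.

Lemma winningE (xi : strategy Q A) :
  winning G xi <->
  (forall w n, w 0%N = init G -> (forall t, (t < n)%N -> follows xi w t) ->
     xi (mkseq w n.+1) != finset.set0) /\
  (forall w, w 0%N = init G -> (forall t, follows xi w t) -> win G w).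
Proof.
split=> -[win_fin win_inf]; split.
- move=> w n w0 /consistent_fin_mkseq.
  by rewrite mkseqS_cons w0; apply: win_fin.
- move=> w w0 fol_w; apply: win_inf => // t.
  by have [a _ tr_a] := fol_w t; exists a.
- move=> s; rewrite nth_cons_mkseq => /consistent_fin_mkseq cons_s.
  exact: win_fin.
- by move=> w _ w0 fol_w; apply: win_inf.
Qed.

End Steps.

Section Lift.
Context {k : nat} {Q : finType}.
Implicit Types (w : nat -> Q) (h : history k Q).

Lemma hseq_inj : injective (@hseq k Q).
Proof. by move=> h h' /val_inj/val_inj. Qed.

Lemma hseq_lift_path w t :
  hseq (lift_path k w t) = drop (t - k) (mkseq w t.+1).
Proof. by rewrite mkseqS_cons /hseq /= size_map size_iota subSS. Qed.

Lemma size_lift_path w t : size (hseq (lift_path k w t)) = (t.+1 - (t - k))%N.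
Proof. by rewrite hseq_lift_path size_drop size_mkseq. Qed.

Lemma lift_path0 w : lift_path k w 0 = hist1 k (w 0%N).
Proof. by apply: hseq_inj; rewrite hseq_lift_path sub0n. Qed.

Lemma lift_pathS w t : lift_path k w t.+1 = hext (lift_path k w t) (w t.+1).
Proof.
apply: hseq_inj; rewrite -[RHS]/(extend k (hseq _) _) /extend size_lift_path.
rewrite !hseq_lift_path -drop1 drop_drop add1n.
have -> : mkseq w t.+2 = rcons (mkseq w t.+1) (w t.+1).
  by rewrite /mkseq -map_rcons -[in iota 0 t.+2]addn1 iotaD cats1.
case: (leqP k t) => [le_kt|lt_tk].
  (* The window is full here, so [extend] discards its oldest entry. *)
  have -> : (t.+1 - (t - k) = k.+1)%N by rewrite subSn ?leq_subr // subKn.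
  by rewrite ltnn -subSn // drop_rcons // size_mkseq leq_subr.
(* Before time [k] both truncated differences vanish and nothing is discarded. *)
rewrite (eqP (lt_tk : (t.+1 - k == 0)%N)) (eqP (ltnW lt_tk : (t - k == 0)%N)).
by rewrite subn0 ltnS lt_tk !drop0.
Qed.

Lemma last_lift_path q w t : last q (hseq (lift_path k w t)) = w t.
Proof.
case: t => [|t]; first by rewrite lift_path0.
by rewrite lift_pathS /hseq /= /extend; case: ifP => _; rewrite last_rcons.
Qed.

Lemma last_hext q h q' : last q (hseq (hext h q')) = q'.
Proof. by rewrite /hseq /= /extend; case: ifP => _; rewrite last_rcons. Qed.

(** Each step appends exactly the last entry of the next history. The bound [n] covers finite plays,
    beyond which [W] is arbitrary. *)
Lemma lift_path_last q (W : nat -> history k Q) n :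
  W 0%N = hist1 k q ->
  (forall t, (t < n)%N -> exists q', W t.+1 = hext (W t) q') ->
  forall t, (t <= n)%N -> W t = lift_path k (fun i => last q (hseq (W i))) t.
Proof.
move=> W0 stepW; elim=> [_|t IHt lt_tn]; first by rewrite lift_path0 W0.
have [q' Wt] := stepW t lt_tn.
by rewrite lift_pathS -IHt ?(ltnW lt_tn) // [in RHS]Wt last_hext.
Qed.

Lemma nth_lift_path (T : Type) (x0 : T) (f : Q -> T) w t i :
  (k <= t)%N -> (i <= k)%N ->
  nth x0 (map f (hseq (lift_path k w t))) (k - i) = f (w (t - i)%N).
Proof.
move=> le_kt le_ik; have eq_ti : (t - k + (k - i) = t - i)%N.
  by rewrite addnBA // subnK.
by rewrite hseq_lift_path map_drop nth_drop eq_ti (nth_map (w 0%N))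
  ?size_mkseq ?nth_mkseq // ltnS leq_subr.
Qed.

End Lift.

Section HistoryGameTheory.
Context {k : nat} {Q A : finType} (G : game Q A).
Variables (Fk : set (nat -> history k Q)) (xik : history k Q -> {set A}).

Lemma of_memoryless_mkseq (W : nat -> history k Q) t :
  of_memoryless xik (mkseq W t.+1) = xik (W t).
Proof.
by rewrite mkseqS_cons /= (last_nth (W 0%N)) -mkseqS_cons size_map size_iota
  nth_mkseq.
Qed.

Lemma induced_mkseq w t : induced xik (mkseq w t.+1) = xik (lift_path k w t).
Proof. by []. Qed.

Lemma follows_lift_path w t :
  follows (history_game G Fk) (of_memoryless xik) (lift_path k w) t <->
  follows G (induced xik) w t.
Proof.
rewrite /follows of_memoryless_mkseq induced_mkseq /= /htrans last_lift_path.
split=> -[a a_xi tr_a]; exists a => //.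
  (* An extension determines the appended state, so comparing last entries identifies [q] with
     [w t.+1]. *)
  have /imsetP[q tr_q] := tr_a; rewrite lift_pathS.
  by move=> /(congr1 (fun h => last (w 0%N) (hseq h))); rewrite !last_hext => ->.
by rewrite lift_pathS; apply: imset_f.
Qed.

Lemma follows_hext (W : nat -> history k Q) t :
  follows (history_game G Fk) (of_memoryless xik) W t ->
  exists q, W t.+1 = hext (W t) q.
Proof. by move=> [a _ /imsetP[q _ ->]]; exists q. Qed.

Lemma history_dependent_induced : history_dependent k.+1 (induced xik).
Proof.
move=> [|q s] [|q' s'] //= eq_drop.
(* If just one sequence is empty, the equality of suffixes would make a window empty. *)
- by have := valP (window k q' s'); rewrite /= -eq_drop.
- by have := valP (window k q s); rewrite /= eq_drop.
- by congr xik; apply: hseq_inj.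
Qed.

Lemma winning_history_game :
  history_win G Fk ->
  winning (history_game G Fk) (of_memoryless xik) <-> winning G (induced xik).
Proof.
move=> Fk_win; rewrite !winningE; split=> -[win_fin win_inf]; split.
- move=> w n w0 fol_w; rewrite induced_mkseq -of_memoryless_mkseq.
  apply: win_fin => [|t /fol_w]; first by rewrite lift_path0 w0.
  by rewrite follows_lift_path.
- move=> w w0 fol_w; apply/Fk_win/win_inf; first by rewrite lift_path0 w0.
  by move=> t; apply/follows_lift_path.
- move=> W n W0 fol_W; rewrite of_memoryless_mkseq.
  pose w t := last (init G) (hseq (W t)).
  have Ww : forall t, (t <= n)%N -> W t = lift_path k w t.
    by apply: lift_path_last => // t /fol_W/follows_hext.
  rewrite Ww // -induced_mkseq; apply: win_fin => [|t lt_tn].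
    by rewrite /w W0.
  apply/follows_lift_path; have := fol_W t lt_tn.
  by rewrite /follows !of_memoryless_mkseq !Ww // ltnW.
- move=> W W0 fol_W; pose w t := last (init G) (hseq (W t)).
  have Ww : W = lift_path k w.
    (* Extensionality is used because [Fk] is a set of functions; the finite bound is taken to be
       [t] itself. *)
    apply/funext => t; apply: (lift_path_last (init G) W t) => // i _.
    exact: follows_hext (fol_W i).
  rewrite Ww; apply/Fk_win/win_inf => [|t]; first by rewrite /w W0.
  by apply/follows_lift_path; rewrite -Ww.
Qed.

End HistoryGameTheory.

Theorem lemma3 (R : realType) (d : nat) (dt : R) (dt_gt0 : 0 < dt)
    (S : {fset 'rV[R]_d}) (A : finType) (k : nat) (k_ge1 : (1 <= k)%N)
    (phi : formula R d) (G : game S A)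
    (G_phi : diff_safety_game dt k phi G)
    (Fk : set (nat -> history k S)) (Fk_win : history_win G Fk) :
  (exists Gset : {set history k S},
     forall w : nat -> S, is_path G w ->
       (win (history_game G Fk) (lift_path k w) <->
        forall t : nat, lift_path k w t \in Gset)) /\
  (forall xik : history k S -> {set A},
     history_dependent k.+1 (induced xik) /\
     (winning (history_game G Fk) (of_memoryless xik) <->
      winning G (induced xik))).
Proof.
split; last first.
  by move=> xik; split;
    [exact: history_dependent_induced|exact: winning_history_game].
case: G_phi => ord_phi winG.
(* A full window has positions [0] to [k], and evaluation at [k] reads only these, never the default
   [0]. Shorter histories are all put in the safe set. *)
pose state_of (h : history k S) i := nth 0 (map val (hseq h)) i.
exists [set h : history k S |
  `[< size (hseq h) = k.+1 -> local_val dt phi (state_of h) k >]]%SET => w _.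
have localE t : (k <= t)%N ->
    local_val dt phi (state_of (lift_path k w t)) k <->
    local_val dt phi (fun t => val (w t)) t.
  move=> le_kt; apply: local_val_local; rewrite ?ord_phi // => i le_ik.
  by rewrite /state_of nth_lift_path.
rewrite /= (Fk_win w) winG /= /fsat ord_phi; split=> [sat_w t|safe_w t le_kt].
  rewrite inE; apply/asboolP; rewrite size_lift_path => size_t.
  (* The size [t.+1 - (t - k)] equals [k.+1], and it is at most [t.+1]. *)
  have le_kt : (k <= t)%N.
    by rewrite -ltnS -size_t leq_subr.
  exact/(localE _ le_kt)/sat_w.
apply/(localE _ le_kt); have := safe_w t; rewrite inE => /asboolP; apply.
by rewrite size_lift_path subSn ?leq_subr // subKn.
Qed.
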